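(* Let $A$ be a real finite-dimensional affine space, $m\in\mathrm{Met}(A)$ a metric with hessian principal component $g\in S^2\vec A^*$ and Cayley–Menger bilinear form $\mathrm{CM}_m:\mathrm{Aff}(\mathrm{Quad}_mA)\to\widehat{\mathrm{Quad}_mA}$, and $Q\in A$ a point. Let $\mathrm{swap}(a,b)=(b,a)$ for $(a,b)\in\mathbb R\oplus\mathbb R$. Consider the linear maps $$v_m\oplus v_Q\oplus\nabla_Q^*:\ \mathbb R\oplus\mathbb R\oplus\vec A\to\mathrm{Aff}(\mathrm{Quad}_mA),\quad(a,b,\vec x)\mapsto a\,v_m+b\,v_Q+\nabla_Q^*(\vec x),$$ $$(v_m,v_Q,\nabla_Q):\ \widehat{\mathrm{Quad}_mA}\to\mathbb R\oplus\mathbb R\oplus\vec A^*,\quad\widehat\delta\mapsto(\langle\widehat\delta,v_m\rangle,\langle\widehat\delta,v_Q\rangle,\nabla_Q\widehat\delta).$$ These two maps are isomorphisms adjoint to each other, and $$(v_m,v_Q,\nabla_Q)\circ\mathrm{CM}_m\circ(v_m\oplus v_Q\oplus\nabla_Q^* )=(\mathrm{swap},-g):\ \mathbb R\oplus\mathbb R\oplus\vec A\to\mathbb R\oplus\mathbb R\oplus\vec A^*.$$ Hence $\widehat{\mathrm{Quad}_mA}$ with the Cayley–Menger metric is isometric to the direct sum of the standard hyperbolic plane $(\mathbb R^2,\mathrm{swap})$ and the metric vector space $(\vec A,-g)$.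
   Context: All spaces are real and finite-dimensional. For an affine space $A$ with director vector space $\vec A$: $\mathrm{Aff}(A)$ is the vector space of affine functions $A\to\mathbb R$, $u$ the constant function $1$; $\vec A^*=\mathrm{Aff}(A)/\langle u\rangle$ is the dual of $\vec A$, $\mathrm df$ the linear part of $f$. The linear hull is $\widehat A=(\mathrm{Aff}(A))^*$; $z_P\in\widehat A$ is evaluation at $P$; $A$ is identified with $\{z:\langle z,u\rangle=1\}$ and $\vec A$ with $\{z:\langle z,u\rangle=0\}$, $\overrightarrow{PQ}=z_Q-z_P$. A function $\delta:A\to\mathbb R$ is quadratic if $\delta(\alpha P+\beta Q)=\alpha(\alpha-\beta)\delta(P)+\beta(\beta-\alpha)\delta(Q)+4\alpha\beta\,\delta(\frac{P+Q}2)$ whenever $\alpha+\beta=1$; $\mathrm{Quad}(A)$ is the vector space of these. With $\delta^h_P(Q)=\frac12(\delta(Q)+\delta(2P-Q))-\delta(P)$, $\delta-\delta^h_P$ is affine and the gradient of $\delta$ at $P$ is $\nabla_P\delta=\mathrm d(\delta-\delta^h_P)\in\vec A^*$; there is a symmetric bilinear form $\mathrm{Hess}\,\delta$ on $\vec A$ (hessian principal component) with $\delta^h_P(Q)=\frac12\mathrm{Hess}\,\delta(\overrightarrow{PQ},\overrightarrow{PQ})$ for all $P,Q$. $\mathrm{Met}(A)=\mathrm{Quad}(A)/\mathrm{Aff}(A)$; for $m\in\mathrm{Met}(A)$, $\mathrm{Quad}_mA\subset\mathrm{Quad}(A)$ is the class $m$, an affine space with director space $\mathrm{Aff}(A)$;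 its elements share the same hessian principal component $g$. The metric $m$ is non-degenerate if $g$ has trivial nullspace. $\delta^m_P\in\mathrm{Quad}_mA$ is $\delta^m_P(Q)=\frac12g(\overrightarrow{PQ},\overrightarrow{PQ})$. $\mathrm{Aff}(\mathrm{Quad}_mA)$ is the vector space of affine functionals $\mathrm{Quad}_mA\to\mathbb R$; its dual is the linear hull $\widehat{\mathrm{Quad}_mA}$, in which $\mathrm{Quad}_mA$ is embedded by evaluation as a spanning affine hyperplane. $v_P(\delta)=\delta(P)$ for $P\in A$, $v_m(\delta)=1$. The affine map $\nabla_Q:\mathrm{Quad}_mA\to\vec A^*$, $\delta\mapsto\nabla_Q\delta$, extends uniquely to a linear map $\nabla_Q:\widehat{\mathrm{Quad}_mA}\to\vec A^*$, and $\nabla_Q^*:\vec A\to\mathrm{Aff}(\mathrm{Quad}_mA)$ is its dual: $\nabla_Q^*(\vec a)(\delta)=\langle\nabla_Q\delta,\vec a\rangle$. $\mathrm d_m:\mathrm{Aff}(\mathrm{Quad}_mA)\to\widehat A$ is $\langle\mathrm d_m\bar v,s\rangle=\bar v(\delta+s)-\bar v(\delta)$, $s\in\mathrm{Aff}(A)$ (independent of $\delta\in\mathrm{Quad}_mA$). $\mathrm{Aff}_0(\mathrm{Quad}_mA)$ is the subspace of $\bar v$ with $\bar v(\delta+\alpha u)=\bar v(\delta)$ for all $\delta,\alpha$; $\mathrm d_m$ maps it into $\vec A$. Bilinear forms on $V$ are identified with linear maps $V\to V^*$; e.g. $\mathrm{swap}$ is the form $((a,b),(c,d))\mapsto ad+bc$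 on $\mathbb R^2$, and $g:\vec A\to\vec A^*$. $\mathrm{CM}_m$ is the unique symmetric bilinear form on $\mathrm{Aff}(\mathrm{Quad}_mA)$ with (1) $\mathrm{CM}_m(v_1,v_2)=-g(\mathrm d_mv_1,\mathrm d_mv_2)$ for $v_1,v_2\in\mathrm{Aff}_0(\mathrm{Quad}_mA)$ and (2) $\mathrm{CM}_m(v_P)=\delta^m_P$ for all $P\in A$ (for $m\ne0$, (2) may equivalently be replaced by $\mathrm{CM}_m(v_P,v_P)=0$ for all $P\in A$). The Cayley–Menger metric on $\widehat{\mathrm{Quad}_mA}$ is the inverse form $\mathrm{CM}_m^{-1}$, $(\widehat\delta_1,\widehat\delta_2)\mapsto\langle\widehat\delta_2,\mathrm{CM}_m^{-1}(\widehat\delta_1)\rangle$; it is defined when $m$ is non-degenerate, in which case $\mathrm{CM}_m$ is invertible. The last sentence of the claim is to be read in that case. *)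

(* Defs.v *)
From HB Require Import structures.
From mathcomp Require Import all_boot all_order all_algebra.
From mathcomp Require Import ring lra.
From mathcomp Require Import ring_quotient generic_quotient sesquilinear.
From mathcomp Require Import mathcomp_extra boolp classical_sets functions.
From mathcomp Require Import reals.

Set Implicit Arguments.
Unset Strict Implicit.
Unset Printing Implicit Defensive.

Import Order.TTheory GRing.Theory Num.Theory.
Local Open Scope ring_scope.
Local Open Scope quotient_scope.

(* The algebraic dual, and below the spaces of affine and of quadratic
   functions, are submodules of a module of all functions: their operations
   are pointwise. *)
Section Dual.
Variables (R : realType) (V : lmodType R).

Definition scalar_pred : {pred V -> R^o} :=
  fun f => `[< linear_for *%R (f : V -> R) >].

Lemma scalar_predP (f : V -> R^o) :
  reflect (linear_for *%R (f : V -> R)) (f \in scalar_pred).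
Proof. exact: asboolP. Qed.

Record dual := Dual { dual_fun :> V -> R^o ; _ : dual_fun \in scalar_pred }.

HB.instance Definition _ := [isSub for dual_fun].
HB.instance Definition _ := [Choice of dual by <:].

Lemma scalar_pred_closed : submod_closed scalar_pred.
Proof.
split=> [|a f h].
  by apply/scalar_predP => b x y /=; rewrite mulr0 addr0.
move=> /scalar_predP hf /scalar_predP hh; apply/scalar_predP => b x y.
rewrite -[LHS]/(a * f _ + h _) hf hh -[(a *: f + h) x]/(a * f x + h x).
rewrite -[(a *: f + h) y]/(a * f y + h y); ring.
Qed.

HB.instance Definition _ :=
  GRing.isSubmodClosed.Build R (V -> R^o) scalar_pred scalar_pred_closed.
HB.instance Definition _ := [SubChoice_isSubLmodule of dual by <:].

Lemma dual_linear (f : dual) : linear_for *%R (f : V -> R).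
Proof. by case: f => f /= /scalar_predP. Qed.

HB.instance Definition _ (f : dual) :=
  GRing.isLinear.Build R V R *%R (dual_fun f) (dual_linear f).

Definition mkdual (f : V -> R) (hf : linear_for *%R f) : dual :=
  Dual (introT (scalar_predP f) hf).

Lemma dual_inj (f h : dual) : (forall x, f x = h x) -> f = h.
Proof. by move=> fh; apply: val_inj; apply: funext. Qed.

Lemma dualD (f h : dual) x : (f + h) x = f x + h x. Proof. by []. Qed.
Lemma dualZ a (f : dual) x : (a *: f) x = a * f x. Proof. by []. Qed.

End Dual.

(* A nonempty torsor under the vector space V; [trans P x] is P + x and
   [vec P Q] is the vector from P to Q. *)
Record affineSpace (R : realType) (V : lmodType R) := AffineSpace {
  point_of :> Type;
  affine_inhabited : inhabited point_of;
  trans : point_of -> V -> point_of;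
  vec : point_of -> point_of -> V;
  transD : forall P x y, trans (trans P x) y = trans P (x + y);
  transK : forall P x, vec P (trans P x) = x;
  vecK : forall P Q, trans P (vec P Q) = Q }.

Section AffineFunctions.
Variables (R : realType) (V : lmodType R) (A : affineSpace V).
Implicit Types (P Q : A) (x y : V).

(* The combination (1 - b) P + b Q. *)
Definition comb (b : R) P Q : A := trans P (b *: vec P Q).

Definition affine_fun (f : A -> R) : Prop :=
  forall (a b : R), a + b = 1 -> forall P Q, f (comb b P Q) = a * f P + b * f Q.

Definition quadratic_fun (f : A -> R) : Prop :=
  forall (a b : R), a + b = 1 -> forall P Q,
    f (comb b P Q) = a * (a - b) * f P + b * (b - a) * f Q
                     + 4 * a * b * f (comb 2^-1 P Q).

Definition affine_pred : {pred A -> R^o} := fun f => `[< affine_fun f >].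
Definition quadratic_pred : {pred A -> R^o} := fun f => `[< quadratic_fun f >].

Lemma affine_predP (f : A -> R^o) : reflect (affine_fun f) (f \in affine_pred).
Proof. exact: asboolP. Qed.

Lemma quadratic_predP (f : A -> R^o) :
  reflect (quadratic_fun f) (f \in quadratic_pred).
Proof. exact: asboolP. Qed.

Record Aff := MkAff { aff_fun :> A -> R^o ; _ : aff_fun \in affine_pred }.
Record Quad :=
  MkQuad { quad_fun :> A -> R^o ; _ : quad_fun \in quadratic_pred }.

HB.instance Definition _ := [isSub for aff_fun].
HB.instance Definition _ := [Choice of Aff by <:].
HB.instance Definition _ := [isSub for quad_fun].
HB.instance Definition _ := [Choice of Quad by <:].

Lemma affine_pred_closed : submod_closed affine_pred.
Proof.
split=> [|c f h].
  by apply/affine_predP => a b _ P Q /=; rewrite !mulr0 addr0.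
move=> /affine_predP hf /affine_predP hh; apply/affine_predP => a b ab P Q.
have e S : (c *: f + h) S = c * f S + h S by [].
by rewrite !e (hf _ _ ab) (hh _ _ ab); ring.
Qed.

Lemma quadratic_pred_closed : submod_closed quadratic_pred.
Proof.
split=> [|c f h].
  by apply/quadratic_predP => a b _ P Q /=; rewrite !mulr0 !addr0.
move=> /quadratic_predP hf /quadratic_predP hh.
apply/quadratic_predP => a b ab P Q.
have e S : (c *: f + h) S = c * f S + h S by [].
by rewrite !e (hf _ _ ab) (hh _ _ ab); ring.
Qed.

HB.instance Definition _ :=
  GRing.isSubmodClosed.Build R (A -> R^o) affine_pred affine_pred_closed.
HB.instance Definition _ := [SubChoice_isSubLmodule of Aff by <:].
HB.instance Definition _ :=
  GRing.isSubmodClosed.Build R (A -> R^o) quadratic_pred quadratic_pred_closed.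
HB.instance Definition _ := [SubChoice_isSubLmodule of Quad by <:].

Lemma aff_affine (f : Aff) : affine_fun f.
Proof. by case: f => f /= /affine_predP. Qed.

Lemma quad_quadratic (f : Quad) : quadratic_fun f.
Proof. by case: f => f /= /quadratic_predP. Qed.

Definition mkaff (f : A -> R) (hf : affine_fun f) : Aff :=
  MkAff (introT (affine_predP f) hf).
Definition mkquad (f : A -> R) (hf : quadratic_fun f) : Quad :=
  MkQuad (introT (quadratic_predP f) hf).

Lemma aff_inj (f h : Aff) : (forall P, f P = h P) -> f = h.
Proof. by move=> fh; apply: val_inj; apply: funext. Qed.

Lemma quad_inj (f h : Quad) : (forall P, f P = h P) -> f = h.
Proof. by move=> fh; apply: val_inj; apply: funext. Qed.

Lemma trans0 P : trans P 0 = P.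
Proof. by rewrite -{1}(vecK P P) transD addr0 vecK. Qed.

Lemma vecxx P : vec P P = 0.
Proof. by rewrite -{2}(trans0 P) transK. Qed.

Lemma vec_trans P x y : vec (trans P x) (trans P y) = y - x.
Proof. by rewrite -{1}(subrK x y) addrC -transD transK. Qed.

Lemma comb_trans P x y b :
  comb b (trans P x) (trans P y) = trans P (x + b *: (y - x)).
Proof. by rewrite /comb vec_trans transD. Qed.

Lemma aff_trans (f : Aff) P x y b :
  f (trans P (x + b *: (y - x))) = (1 - b) * f (trans P x) + b * f (trans P y).
Proof. by rewrite -comb_trans (aff_affine f (subrK b 1)). Qed.

Lemma quad_trans (f : Quad) P x y b :
  f (trans P (x + b *: (y - x))) =
    (1 - b) * (1 - b - b) * f (trans P x)
    + b * (b - (1 - b)) * f (trans P y)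
    + 4 * (1 - b) * b * f (trans P (x + 2^-1 *: (y - x))).
Proof. by rewrite -!comb_trans (quad_quadratic f (subrK b 1)). Qed.

Lemma affine_quadratic (f : Aff) : quadratic_fun f.
Proof.
move=> a b ab P Q.
have h2 : 2^-1 + 2^-1 = 1 :> R by field.
rewrite (aff_affine f ab) (aff_affine f h2).
have -> : a = 1 - b by rewrite -ab addrK.
by field.
Qed.

Definition quad_of_aff (f : Aff) : Quad := mkquad (affine_quadratic f).

Lemma linear_part_indep (f : Aff) P Q x :
  f (trans P x) - f P = f (trans Q x) - f Q.
Proof.
have [y ->] : exists y, Q = trans P y by exists (vec P Q); rewrite vecK.
have := aff_trans f P x y 2^-1; have := aff_trans f P 0 (x + y) 2^-1.
rewrite subr0 add0r transD trans0 [y + x]addrC.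
have -> : x + 2^-1 *: (y - x) = 2^-1 *: (x + y).
  rewrite scalerBr addrC scalerDr -addrA [RHS]addrC; congr (_ + _).
  by rewrite -{2}[x]scale1r -scaleNr -scalerDl; congr (_ *: _); field.
by move=> -> ; lra.
Qed.

Lemma linear_part_linear (f : Aff) P :
  linear_for *%R (fun x => f (trans P x) - f P).
Proof.
move=> a x y.
have hZ : f (trans P (a *: x)) - f P = a * (f (trans P x) - f P).
  by have := aff_trans f P 0 x a; rewrite subr0 add0r trans0 => ->; ring.
rewrite -transD -hZ -(linear_part_indep f (trans P (a *: x)) P y); ring.
Qed.

Definition base_point : A := inhabited_witness (affine_inhabited A).

(* The linear part of f, i.e. f (P + x) - f P for any P (see [diffE]). *)
Definition diff (f : Aff) : dual V := mkdual (linear_part_linear f base_point).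

Lemma diffE (f : Aff) P x : diff f x = f (trans P x) - f P.
Proof. exact: linear_part_indep. Qed.

Lemma cst_affine (c : R) : affine_fun (fun=> c).
Proof. by move=> a b ab P Q; rewrite -mulrDl ab mul1r. Qed.

Definition cst_aff (c : R) : Aff := mkaff (cst_affine c).

End AffineFunctions.

(* A function on a vector space that is quadratic on every line, split into
   its odd part, which is linear, and its even part, which satisfies the
   parallelogram law. *)
Section LineQuadratic.
Variables (R : realType) (V : lmodType R) (f : V -> R).
Hypothesis f_quad : forall x y b,
  f (x + b *: (y - x)) =
    (1 - b) * (1 - b - b) * f x + b * (b - (1 - b)) * f y
    + 4 * (1 - b) * b * f (x + 2^-1 *: (y - x)).

Let e x := 2^-1 * (f x + f (- x)) - f 0.
Let o x := 2^-1 * (f x - f (- x)).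

Lemma lq_line x v t : f (x + t *: v) =
  f x + t * (2^-1 * (f (x + v) - f (x - v)))
  + t ^+ 2 * (2^-1 * (f (x + v) + f (x - v)) - f x).
Proof.
have := f_quad x (x + v) t; have := f_quad x (x + v) (- 1).
have -> : x + v - x = v by rewrite addrC addKr.
rewrite scaleN1r => e1 ->; rewrite e1; by field.
Qed.

Let lineN x v t : f (- (x + t *: v)) =
  f (- x) + t * (2^-1 * (f (- (x + v)) - f (- (x - v))))
  + t ^+ 2 * (2^-1 * (f (- (x + v)) + f (- (x - v))) - f (- x)).
Proof. by rewrite !opprD -scalerN lq_line. Qed.

Let e_line x v t : e (x + t *: v) =
  e x + t * (2^-1 * (e (x + v) - e (x - v)))
  + t ^+ 2 * (2^-1 * (e (x + v) + e (x - v)) - e x).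
Proof. rewrite /e lq_line lineN; by field. Qed.

Let o_line x v t : o (x + t *: v) =
  o x + t * (2^-1 * (o (x + v) - o (x - v)))
  + t ^+ 2 * (2^-1 * (o (x + v) + o (x - v)) - o x).
Proof. rewrite /o lq_line lineN; by field. Qed.

Let eN x : e (- x) = e x. Proof. by rewrite /e opprK [f (- x) + _]addrC. Qed.
Let oN x : o (- x) = - o x. Proof. rewrite /o opprK; ring. Qed.
Let e0 : e 0 = 0. Proof. rewrite /e oppr0; by field. Qed.
Let o0 : o 0 = 0. Proof. rewrite /o oppr0; ring. Qed.

Lemma lq_evenZ t x : e (t *: x) = t ^+ 2 * e x.
Proof. have := e_line 0 x t; rewrite !add0r eN e0 => ->; by field. Qed.

Lemma lq_oddZ t x : o (t *: x) = t * o x.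
Proof. have := o_line 0 x t; rewrite !add0r oN o0 => ->; by field. Qed.

Let swap_line (x y : V) (t : R) : t != 0 -> x + t *: y = t *: (y + t^-1 *: x).
Proof.
by move=> t0; rewrite scalerDr scalerA mulfV // scale1r addrC.
Qed.

Let two_neq0 : 2 != 0 :> R. Proof. by rewrite pnatr_eq0. Qed.

Lemma lq_parallelogram x y : e (x + y) + e (x - y) = 2 * e x + 2 * e y.
Proof.
have := e_line x y 2; rewrite (swap_line _ _ two_neq0).
rewrite lq_evenZ e_line [y + x]addrC -[y - x]opprB eN; lra.
Qed.

Lemma lq_oddD x y : o (x + y) = o x + o y.
Proof.
have := o_line x y 2; rewrite (swap_line _ _ two_neq0).
rewrite lq_oddZ o_line [y + x]addrC -[y - x]opprB oN.
have := o_line x y (- 2); rewrite (swap_line _ _ (_ : - 2 != 0 :> R)) ?oppr_eq0 //.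
rewrite lq_oddZ o_line [y + x]addrC -[y - x]opprB oN invrN; lra.
Qed.

Lemma lq_evenD3 x y z : e (x + y + z) =
  e (x + y) + e (y + z) + e (x + z) - e x - e y - e z.
Proof.
have := lq_parallelogram (x + y) z; have := lq_parallelogram x (y - z).
have := lq_parallelogram (x + z) y; have := lq_parallelogram y z.
have -> : x + (y - z) = x + y - z by rewrite addrA.
have -> : x - (y - z) = x + z - y by rewrite opprB addrA.
have -> : x + z + y = x + y + z by rewrite addrAC.
lra.
Qed.

Lemma lq_odd_linear : linear_for *%R o.
Proof. by move=> a x y; rewrite lq_oddD lq_oddZ. Qed.

Let g x y := e (x + y) - e x - e y.

Lemma lq_polar_sym x y : g x y = g y x.
Proof. by rewrite /g [x + y]addrC addrAC. Qed.

Lemma lq_polar_linear y : linear_for *%R (g y).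
Proof.
have gZ a x : g y (a *: x) = a * g y x.
  have eB : e (y - x) = 2 * e y + 2 * e x - e (y + x).
    by have := lq_parallelogram y x; lra.
  by rewrite /g e_line lq_evenZ eB; field.
move=> a x z; rewrite -gZ /g addrA lq_evenD3; lra.
Qed.

Lemma lq_polar_diag x : e x = 2^-1 * g x x.
Proof.
have -> : g x x = 2 * e x; last by field.
by rewrite /g -{1 2}[x]scale1r -scalerDl lq_evenZ; ring.
Qed.

End LineQuadratic.

Section SymmetricForms.
Variables (R : realType) (V : lmodType R).

Section Build.
Variable f : V -> V -> R.
Hypothesis fC : forall x y, f x y = f y x.
Hypothesis f_lin : forall x, linear_for *%R (f x).

Let f_linl y : linear_for *%R (f^~ y).
Proof. by move=> a x z; rewrite fC f_lin fC [f y z]fC. Qed.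

Let f_herm x y : f x y = (-1) ^+ false * idfun (f y x).
Proof. by rewrite mul1r fC. Qed.

Definition mksym : {symmetric V} :=
  HB.pack f
    (isBilinear.Build R V V R *%R (idfun \; *%R) f
      (fun y => zmod_morphism_linear (f_linl y))
      (fun x => zmod_morphism_linear (f_lin x))
      (fun y => scalable_linear (f_linl y))
      (fun x => scalable_linear (f_lin x)))
    (isHermitianSesquilinear.Build R V false idfun f f_herm).

End Build.

Lemma zero_form_linear (x : V) : linear_for *%R (fun _ : V => 0 : R).
Proof. by move=> a y z; rewrite mulr0 addr0. Qed.

Definition zero_form : {symmetric V} :=
  mksym (f := fun _ _ => 0) (fun _ _ => erefl) zero_form_linear.

Lemma form_linear (B : {symmetric V}) (x : V) : linear_for *%R (B x).
Proof. by move=> a y z; rewrite linearD linearZ. Qed.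

(* A bilinear form as a linear map from V to its dual. *)
Definition flat (B : {symmetric V}) (x : V) : dual V := mkdual (form_linear B x).

(* The inverse form of B, on the dual of V; it is meaningful when [flat B] is
   bijective. *)
Definition inverse_form (B : {symmetric V}) (s t : dual V) : R :=
  t ('pinv_(fun=> 0) [set: V] (flat B) s).

End SymmetricForms.

Section Quadratic.
Variables (R : realType) (V : lmodType R) (A : affineSpace V).
Implicit Types (P Q : A) (x y : V) (d : Quad A).

(* [comb (- 1) P Q] is 2 P - Q. *)
Definition homog_fun P (f : A -> R) Q : R :=
  2^-1 * (f Q + f (comb (- 1) P Q)) - f P.

Lemma homog_trans P (f : A -> R) x :
  homog_fun P f (trans P x) = 2^-1 * (f (trans P x) + f (trans P (- x))) - f P.
Proof. by rewrite /homog_fun /comb transK scaleN1r. Qed.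

Lemma homog_quadratic P d : quadratic_fun (homog_fun P d).
Proof.
move=> a b ab Q S.
have hr c : comb (- 1) P (comb c Q S) = comb c (comb (- 1) P Q) (comb (- 1) P S).
  rewrite -(vecK P Q) -(vecK P S); move: (vec P Q) (vec P S) => x y.
  rewrite comb_trans /comb !transK !vec_trans !transD !scaleN1r.
  by rewrite opprD -scalerN opprB opprK [- y + x]addrC.
rewrite /homog_fun !hr !(quad_quadratic d ab).
have -> : a = 1 - b by rewrite -ab addrK.
ring.
Qed.

Definition homog P d : Quad A := mkquad (homog_quadratic P d).

Lemma homogE P d x : homog P d (trans P x) =
  2^-1 * (d (trans P x) + d (trans P (- x))) - d P.
Proof. exact: homog_trans. Qed.

Lemma remainder_affine P d : affine_fun (fun Q => d Q - homog P d Q).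
Proof.
move=> a b ab Q S; rewrite -(vecK P Q) -(vecK P S).
move: (vec P Q) (vec P S) => x y; rewrite comb_trans !homogE.
pose f z := d (trans P z).
have fq z t c : f (z + c *: (t - z)) =
    (1 - c) * (1 - c - c) * f z + c * (c - (1 - c)) * f t
    + 4 * (1 - c) * c * f (z + 2^-1 *: (t - z)) by exact: quad_trans.
have hD := lq_oddD fq; have hZ := lq_oddZ fq; rewrite /f /= in hD hZ.
have := hD x (b *: (y - x)); have := hZ b (y - x); have := hD y (- x).
have := hZ (- 1) x; rewrite scaleN1r opprK => e1 e2 e3 e4.
have -> : a = 1 - b by rewrite -ab addrK.
move: e1 e2 e3 e4.
set u1 := d _; set u2 := d _; set u3 := d (trans P (y - x)).
nra.
Qed.

(* The affine function d - homog P d. *)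
Definition remainder P d : Aff A := mkaff (remainder_affine P d).

Definition grad P d : dual V := diff (remainder P d).

Lemma gradE P d x : grad P d x = 2^-1 * (d (trans P x) - d (trans P (- x))).
Proof.
have remE y : remainder P d (trans P y) =
    2^-1 * (d (trans P y) - d (trans P (- y))) + d P.
  rewrite -[LHS]/(d (trans P y) - homog P d (trans P y)) homogE; by field.
have rem0 : remainder P d P = d P.
  by have := remE 0; rewrite oppr0 trans0 subrr mulr0 add0r.
by rewrite /grad (diffE _ P) remE rem0 addrK.
Qed.

Definition polar d x y : R :=
  let P := base_point A in
  homog P d (trans P (x + y)) - homog P d (trans P x) - homog P d (trans P y).

Lemma polar_sym d x y : polar d x y = polar d y x.
Proof. by rewrite /polar [x + y]addrC addrAC. Qed.

Let quad_line d P x y c :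
    d (trans P (x + c *: (y - x))) =
    (1 - c) * (1 - c - c) * d (trans P x) + c * (c - (1 - c)) * d (trans P y)
    + 4 * (1 - c) * c * d (trans P (x + 2^-1 *: (y - x))).
Proof. exact: quad_trans. Qed.

Let homogE0 P d x : homog P d (trans P x) =
  2^-1 * (d (trans P x) + d (trans P (- x))) - d (trans P 0).
Proof. by rewrite homogE trans0. Qed.

Lemma polar_linear d x : linear_for *%R (polar d x).
Proof.
move=> a y z; rewrite /polar !homogE0.
exact: (lq_polar_linear (f := fun v => d (trans _ v)) (quad_line d _)).
Qed.

(* The hessian principal component of d, by polarization of [homog]. *)
Definition hess d : {symmetric V} := mksym (polar_sym d) (polar_linear d).

Lemma hessP d P Q : homog P d Q = 2^-1 * hess d (vec P Q) (vec P Q).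
Proof.
pose B := base_point A; pose f v := d (trans B v).
have fq := quad_line d B; rewrite -/f in fq.
rewrite -{1}(vecK P Q); move: (vec P Q) => x.
have hx : homog B d (trans B x) = 2^-1 * hess d x x.
  have := lq_polar_diag (f := f) fq x; rewrite -!homogE0; exact.
rewrite -hx -(vecK B P); move: (vec B P) => v.
rewrite homogE !transD homogE0.
have := lq_parallelogram (f := f) fq v x.
have := lq_oddD (f := f) fq v x; have := lq_oddD (f := f) fq v (- x).
have := lq_oddZ (f := f) fq (- 1) x; rewrite scaleN1r opprK /f; lra.
Qed.

End Quadratic.

Section Metrics.
Variables (R : realType) (V : lmodType R) (A : affineSpace V).
Implicit Types (P Q : A) (x : V) (d e : Quad A) (s : Aff A).

Definition affine_quad : {pred Quad A} := fun d => `[< affine_fun d >].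

Lemma affine_quadP d : reflect (affine_fun d) (d \in affine_quad).
Proof. exact: asboolP. Qed.

Lemma affine_quad_closed : zmod_closed affine_quad.
Proof.
split=> [|d e]; first by apply/affine_quadP => a b _ P Q /=; rewrite !mulr0 addr0.
move=> /affine_quadP hd /affine_quadP he; apply/affine_quadP => a b ab P Q.
have E S : (d - e) S = d S - e S by [].
by rewrite !E (hd _ _ ab) (he _ _ ab); ring.
Qed.

HB.instance Definition _ :=
  GRing.isZmodClosed.Build (Quad A) affine_quad affine_quad_closed.

(* Met(A) = Quad(A) / Aff(A). *)
Definition Met := Quotient.quot affine_quad.

Lemma met_eqP d e :
  reflect (affine_fun (fun P => d P - e P)) (\pi_Met d == \pi_Met e).
Proof. by rewrite -Quotient.idealrBE; exact: (affine_quadP (d - e)). Qed.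

Record QuadM_type (m : Met) := MkQuadM {
  quadM_quad :> Quad A;
  quadM_class : \pi_Met quadM_quad = m }.

Lemma quadM_inj m (d e : QuadM_type m) : (forall P, d P = e P) -> d = e.
Proof.
case: d e => d dm [e em] /= de; have E : d = e by exact: quad_inj.
by rewrite E in dm *; congr MkQuadM; exact: Prop_irrelevance.
Qed.

Lemma quadM_diff_affine m (d e : QuadM_type m) :
  affine_fun (fun P => e P - d P).
Proof. by apply/met_eqP; rewrite !quadM_class. Qed.

Lemma quadM_trans_class m (d : QuadM_type m) s :
  \pi_Met (quadM_quad d + quad_of_aff s) = m.
Proof.
apply: etrans (quadM_class d); apply/eqP/met_eqP => a b ab P Q.
have E S : (quadM_quad d + quad_of_aff s) S - d S = s S.
  by rewrite -[LHS]/(d S + s S - d S) addrC addKr.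
by rewrite !E (aff_affine s ab).
Qed.

Definition quadM_trans m (d : QuadM_type m) s : QuadM_type m :=
  MkQuadM (quadM_trans_class d s).
Definition quadM_vec m (d e : QuadM_type m) : Aff A :=
  mkaff (quadM_diff_affine d e).

Lemma quadM_inhabited m : inhabited (QuadM_type m).
Proof. by constructor; exists (repr m); exact: reprK. Qed.

Lemma quadM_transD m (d : QuadM_type m) s t :
  quadM_trans (quadM_trans d s) t = quadM_trans d (s + t).
Proof. by apply: quadM_inj => P; rewrite /= -[LHS]addrA. Qed.

Lemma quadM_transK m (d : QuadM_type m) s : quadM_vec d (quadM_trans d s) = s.
Proof.
by apply: aff_inj => P; rewrite -[LHS]/(d P + s P - d P) addrC addKr.
Qed.

Lemma quadM_vecK m (d e : QuadM_type m) : quadM_trans d (quadM_vec d e) = e.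
Proof.
by apply: quadM_inj => P; rewrite -[LHS]/(d P + (e P - d P)) addrC subrK.
Qed.

(* Quad_m(A), an affine space with director space Aff(A). *)
Definition QuadM (m : Met) : affineSpace (Aff A) :=
  AffineSpace (@quadM_inhabited m) (@quadM_transD m) (@quadM_transK m)
    (@quadM_vecK m).

(* The hessian principal component of m; see [metric_formE]. *)
Definition metric_form (m : Met) : {symmetric V} := hess (repr m).

Lemma metric_formE m (d : QuadM m) P Q :
  homog P d Q = 2^-1 * metric_form m (vec P Q) (vec P Q).
Proof.
rewrite -hessP -[LHS]/(homog_fun P d Q) -[RHS]/(homog_fun P (repr m) Q).
have r_class : \pi_Met (repr m) = m by exact: reprK.
have h2 : 2 + - 1 = 1 :> R by ring.
have := quadM_diff_affine (MkQuadM r_class) d h2 P Q.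
rewrite /homog_fun /=; lra.
Qed.

Definition met_point (m : Met) : QuadM m := MkQuadM (reprK m).

(* delta^m_P, with value half the square of the vector from P to Q. *)
Lemma delta_quadratic m P :
  quadratic_fun (fun Q => 2^-1 * metric_form m (vec P Q) (vec P Q)).
Proof.
have E Q := metric_formE (met_point m) P Q.
by move=> a b ab Q S; rewrite -!E (quad_quadratic (homog P _) ab).
Qed.

Lemma delta_class m P : \pi_Met (mkquad (delta_quadratic m P)) = m.
Proof.
apply: etrans (reprK m); apply/eqP/met_eqP => a b ab Q S.
have E T : mkquad (delta_quadratic m P) T - (repr m : Quad A) T =
    - remainder P (repr m) T.
  by rewrite -[LHS]/(2^-1 * metric_form m _ _ - _)
       -(metric_formE (met_point m)) -[remainder _ _ _]/(_ - _) opprB.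
by rewrite !E (aff_affine _ ab); ring.
Qed.

Definition delta m P : QuadM m := MkQuadM (delta_class m P).

Lemma grad_affine m Q x : affine_fun (fun d : QuadM m => grad Q d x).
Proof.
move=> a b ab d e; rewrite !gradE.
have E T : (comb b d e : QuadM m) T = d T + b * (e T - d T) by [].
by rewrite !E -[a](addrK b) ab; ring.
Qed.

(* nabla_Q^*(x) : d |-> <grad Q d, x>. *)
Definition gradT m Q x : Aff (QuadM m) := mkaff (@grad_affine m Q x).

Lemma eval_affine m P : affine_fun (fun d : QuadM m => d P).
Proof.
move=> a b ab d e; rewrite -[LHS]/(d P + b * (e P - d P)).
by rewrite -[a](addrK b) ab; ring.
Qed.

Definition v_at m P : Aff (QuadM m) := mkaff (@eval_affine m P).
Definition v_m m : Aff (QuadM m) := cst_aff (QuadM m) 1.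

End Metrics.

Section Hull.
Variables (R : realType) (V : lmodType R) (A : affineSpace V).

(* The linear hull, with A embedded by evaluation. *)
Definition hull := dual (Aff A).

Lemma ev_linear (P : A) : linear_for *%R (fun f : Aff A => f P).
Proof. by []. Qed.

Definition ev (P : A) : hull := mkdual (ev_linear P).

Lemma vec_hull_linear (x : V) : linear_for *%R (fun f : Aff A => diff f x).
Proof.
move=> a f h; rewrite !(diffE _ (base_point A)).
rewrite -[(a *: f + h) _]/(a * f _ + h _) -[(a *: f + h) _]/(a * f _ + h _).
ring.
Qed.

(* The vector x seen in the linear hull; it is [ev (trans P x) - ev P]. *)
Definition vec_hull (x : V) : hull := mkdual (vec_hull_linear x).

End Hull.

Section CayleyMenger.
Variables (R : realType) (V : lmodType R) (A : affineSpace V).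
Variable m : Met A.

(* By [diffE], <d_m v, s> = v (d + s) - v d for every d and s. *)
Definition d_m (v : Aff (QuadM m)) : hull A := diff v.

Definition in_Aff0 (v : Aff (QuadM m)) : Prop :=
  forall (d : QuadM m) (a : R), v (trans d (a *: cst_aff A 1)) = v d.

(* In the first condition [x1] and [x2] are the elements d_m v1 and d_m v2,
   which lie in the image of V in the linear hull of A. *)
Definition is_CM (B : {symmetric Aff (QuadM m)}) : Prop :=
  (forall (v1 v2 : Aff (QuadM m)) (x1 x2 : V),
      in_Aff0 v1 -> in_Aff0 v2 ->
      d_m v1 = vec_hull A x1 -> d_m v2 = vec_hull A x2 ->
      B v1 v2 = - metric_form m x1 x2) /\
  (forall P : A, flat B (v_at m P) = ev (delta m P)).

(* The form satisfying [is_CM]; the default value is never used when V has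
   finite dimension. *)
Definition CM : {symmetric Aff (QuadM m)} :=
  if pselect (exists B, is_CM B) is left h then projT1 (cid h)
  else zero_form (Aff (QuadM m)).

Lemma gradT_linear (Q : A) (h : hull (QuadM m)) :
  linear_for *%R (fun x => h (gradT m Q x)).
Proof.
move=> a x y; rewrite -linearP; congr (h _); apply: aff_inj => d.
by rewrite -[LHS]/(grad Q d (a *: x + y)) linearP.
Qed.

Lemma hgrad_exists (Q : A) :
  exists N : {linear hull (QuadM m) -> dual V},
    forall d : QuadM m, N (ev d) = grad Q d.
Proof.
pose f (h : hull (QuadM m)) := mkdual (gradT_linear Q h).
have fl : linear f by move=> a h k; apply: dual_inj.
pose N : {linear hull (QuadM m) -> dual V} :=
  HB.pack f (GRing.isLinear.Build R _ _ *:%R f fl).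
by exists N => d; apply: dual_inj.
Qed.

(* The linear extension of [grad Q] to the linear hull of Quad_m(A); it is
   unique when V has finite dimension, since then Quad_m(A) spans its hull. *)
Definition hgrad (Q : A) : {linear hull (QuadM m) -> dual V} :=
  projT1 (cid (hgrad_exists Q)).

(* The map v_m + v_Q + nabla_Q^*. *)
Definition aff_of_triple (Q : A) (p : R^o * R^o * V) : Aff (QuadM m) :=
  p.1.1 *: v_m m + p.1.2 *: v_at m Q + gradT m Q p.2.

(* The map (v_m, v_Q, nabla_Q). *)
Definition triple_of_hull (Q : A) (h : hull (QuadM m)) : R^o * R^o * dual V :=
  (h (v_m m) : R^o, h (v_at m Q) : R^o, hgrad Q h).

End CayleyMenger.

Section LinearAlgebra.
Variable R : realType.

Definition is_isomorphism (U W : lmodType R) (f : U -> W) : Prop :=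
  linear f /\ bijective f.

Definition pairing (V : lmodType R) (s : R^o * R^o * dual V)
    (p : R^o * R^o * V) : R :=
  s.1.1 * p.1.1 + s.1.2 * p.1.2 + s.2 p.2.

Definition swap (p : R^o * R^o) : R^o * R^o := (p.2, p.1).

Definition swap_form (p q : R^o * R^o) : R := p.1 * q.2 + p.2 * q.1.

Definition sum_form (U W : lmodType R) (B : U -> U -> R) (C : W -> W -> R)
    (p q : U * W) : R := B p.1 q.1 + C p.2 q.2.

Definition isometric (U W : lmodType R) (B : U -> U -> R) (C : W -> W -> R) :
    Prop :=
  exists f : U -> W, is_isomorphism f /\ forall x y, C (f x) (f y) = B x y.

End LinearAlgebra.

(* Main.v *)
Require Import Defs.
From HB Require Import structures.
From mathcomp Require Import all_boot all_order all_algebra.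
From mathcomp Require Import ring lra.
From mathcomp Require Import sesquilinear boolp classical_sets functions reals.

Set Implicit Arguments.
Unset Strict Implicit.
Unset Printing Implicit Defensive.

Import GRing.Theory.
Local Open Scope ring_scope.

(** The reason behind the statement is the second order Taylor formula: for
    d in Quad_m(A) and P = Q + x,
      d(P) = d(Q) + <grad_Q d, x> + g(x, x) / 2,
    so that an element of Quad_m(A) is the same thing as its value and its
    gradient at Q.  Dually, the affine functionals v_m, v_Q and nabla_Q^*(x)
    should be coordinates on Aff(Quad_m A); write T for the map
    (a, b, x) |-> a v_m + b v_Q + nabla_Q^*(x).

    T is bijective ([aff_of_triple_bijective]) because the linear part d_m of
    T(a, b, x), an element of the linear hull of A, is b z_Q + x, every element
    of that hull has a unique expression of this kind ([hull_decomp], which is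
    the reflexivity of the director space, and [diff_separates]), and the
    functionals with zero linear part are the constants a v_m.  The map (v_m, v_Q, nabla_Q) is the
    transpose of T ([pairing_adjoint]), hence also bijective.

    For the Cayley-Menger form, the Taylor formula says that
      v_P = T(g(x, x) / 2, 1, x),
    and evaluation at delta^m_P sends the functional T(a, b, y) to
      a + b g(x, x) / 2 - g(x, y) ([aff_of_triple_delta]).  So the form
      (a b' + b a') - g(x, x')
    transported by T satisfies both defining properties, which gives existence
    ([is_CM_exists]).  Conversely these properties determine the values of any
    such form on v_Q and on the functionals T(a, 0, x), which make up
    Aff_0(Quad_m A) and have linear part x; hence the formula for the
    Cayley-Menger form in the coordinates T ([is_CM_in_triple_coordinates]).
    The block form (swap, - g) of the composite map, the invertibility and the
    isometry for non-degenerate g are read off from it. *)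

(** * Duality for finite-dimensional spaces *)

Section Duality.
Context {R : realType}.
Implicit Types V : vectType R.

Lemma dual_sumE (U : lmodType R) n (f : 'I_n -> dual U) u :
  (\sum_i f i) u = \sum_i f i u.
Proof. exact: (big_morph (fun h : dual U => h u : R)). Qed.

(** A space U isomorphic to a finite-dimensional one is reflexive.  Carrying the
    isomorphism along lets this apply to spaces of affine functionals, which
    come with no basis of their own: the basis of V and its dual basis are
    transported by T and S. *)
Lemma bidual_eval V (U : lmodType R) (T : V -> U) (S : U -> V) :
  linear T -> linear S -> cancel S T ->
  forall phi : dual (dual U), exists u, forall f, phi f = f u.
Proof.
move=> T_lin S_lin ST phi.
pose b := vbasis (fullv : {vspace V}).
have e_lin i : linear_for *%R (fun u => coord b i (S u) : R).
  by move=> a u w; rewrite S_lin linearP.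
pose e i : dual U := mkdual (e_lin i).
pose T' : {linear V -> U} :=
  HB.pack T (GRing.isLinear.Build R _ _ *:%R T T_lin).
exists (\sum_(i < \dim {:V}) phi (e i) *: T' b`_i) => f.
have f_e : f = \sum_(i < \dim {:V}) f (T' b`_i) *: e i.
  apply: dual_inj => u; rewrite dual_sumE.
  have {1}-> : u = T' (\sum_(i < \dim {:V}) coord b i (S u) *: b`_i).
    by rewrite -coord_vbasis ?memvf //= ST.
  rewrite !linear_sum; apply: eq_bigr => i _.
  by rewrite !linearZ dualZ /= mulrC.
rewrite {1}f_e !linear_sum; apply: eq_bigr => i _.
by rewrite !linearZ; apply: mulrC.
Qed.

Lemma vect_bidual_eval V (phi : dual (dual V)) :
  exists x, forall f, phi f = f x.
Proof. by apply: (@bidual_eval V V id id) => // ? ? ?. Qed.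

Lemma dual_separates V (x : V) : (forall f : dual V, f x = 0) -> x = 0.
Proof.
move=> f0; rewrite (coord_vbasis (memvf x)) big1 // => i _.
have c_lin : linear_for *%R (fun u => coord (vbasis fullv) i u : R).
  by move=> a u w; rewrite linearP.
by rewrite [coord _ _ _](f0 (mkdual c_lin)) scale0r.
Qed.

Lemma flat_linear (U : lmodType R) (B : {symmetric U}) : linear (flat B).
Proof. by move=> a x y; apply: dual_inj => z; rewrite /= linearPl. Qed.

(** The classical equality of dimensions, in coordinates: x |-> g(x, _) composed
    with the basis isomorphism from the dual to V is an injective endomorphism
    of V, hence onto. *)
Lemma flat_bijective V (g : {symmetric V}) :
  nondegenerate g -> bijective (flat g).
Proof.
move=> g_nd.
pose b := vbasis (fullv : {vspace V}).
(* F is flat g followed by the identification of a form with its values on the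
   basis b. *)
pose F x : V := \sum_(i < \dim {:V}) g x b`_i *: b`_i.
have F_lin : linear F.
  move=> a x y; rewrite /F scaler_sumr -big_split; apply: eq_bigr => i _ /=.
  by rewrite linearPl scalerA -scalerDl.
pose F' : {linear V -> V} :=
  HB.pack F (GRing.isLinear.Build R _ _ *:%R F F_lin).
have b_free := basis_free (vbasisP (fullv : {vspace V})).
have flat_eq (f : dual V) (x : V) :
    (forall i : 'I_(\dim {:V}), g x b`_i = f b`_i) -> flat g x = f.
  move=> gf; apply: dual_inj => y; rewrite (coord_vbasis (memvf y)).
  by rewrite !linear_sum; apply: eq_bigr => i _; rewrite !linearZ /= gf.
have coordF (c : 'I_(\dim {:V}) -> R) x :
    F x = \sum_(i < \dim {:V}) c i *: b`_i ->
    forall i : 'I_(\dim {:V}), g x b`_i = c i.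
  move=> Fx i; have := congr1 (coord b i) Fx.
  by rewrite !coord_sum_free.
have g_inj x y : flat g x = flat g y -> x = y.
  move=> gxy; apply/eqP; rewrite -subr_eq0 -memv0 -(eqP g_nd).
  apply/mem_orthovP => z _; rewrite linearBl.
  by move: (congr1 (fun h : dual V => h z) gxy) => /= ->; rewrite subrr.
have F_inj : lker (linfun F') == 0%VS.
  apply/lker0P => x y; rewrite !lfunE /= => Fxy.
  by apply/g_inj/flat_eq/coordF.
pose inv (f : dual V) :=
  ((linfun F')^-1)%VF (\sum_(i < \dim {:V}) f b`_i *: b`_i).
have invK : cancel inv (flat g).
  move=> f; apply: flat_eq; apply: (coordF (fun i => f b`_i)).
  by rewrite -[F _]/(F' _) -[F' _]lfunE lker0_lfunVK.
by exists inv => // x; apply: g_inj; rewrite invK.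
Qed.
End Duality.

(** * Linear maps, functionals and forms *)

Lemma inj_surj_bijective (X Y : Type) (f : X -> Y) :
  injective f -> (forall y, exists x, f x = y) -> bijective f.
Proof.
move=> f_inj /choice [h hK]; exists h => // x.
by apply: f_inj; rewrite hK.
Qed.

Lemma inverse_linear (R : realType) (U W : lmodType R)
    (f : U -> W) (h : W -> U) :
  linear f -> cancel f h -> cancel h f -> linear h.
Proof.
by move=> f_lin fK hK a x y; rewrite -{1}(hK x) -{1}(hK y) -f_lin fK.
Qed.

(** The rules for linear and bilinear maps, with values in R and not in the
    regular module of R, so that [ring] and [lra] apply to the results. *)
Section DualArith.
Context {R : realType} {U : lmodType R}.
Implicit Types (f : dual U) (x y : U).

Lemma dual_argD f x y : f (x + y) = f x + f y. Proof. exact: linearD. Qed.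
Lemma dual_arg0 f : f 0 = 0. Proof. exact: linear0. Qed.
Lemma dual_argN f x : f (- x) = - f x. Proof. exact: linearN. Qed.
Lemma dual_argZ f a x : f (a *: x) = a * f x. Proof. exact: linearZ. Qed.

Lemma formC (B : {symmetric U}) x y : B x y = B y x.
Proof. by rewrite hermC /= expr0 mul1r. Qed.

Lemma formDr (B : {symmetric U}) x y z : B x (y + z) = B x y + B x z.
Proof. exact: linearDr. Qed.

Lemma formNr (B : {symmetric U}) x y : B x (- y) = - B x y.
Proof. exact: linearNr. Qed.

Lemma form0r (B : {symmetric U}) x : B x 0 = 0.
Proof. exact: linear0r. Qed.

Lemma formZr (B : {symmetric U}) a x y : B x (a *: y) = a * B x y.
Proof. exact: linearZr. Qed.

Lemma formDl (B : {symmetric U}) x y z : B (y + z) x = B y x + B z x.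
Proof. exact: linearDl. Qed.

Lemma formNl (B : {symmetric U}) x y : B (- y) x = - B y x.
Proof. exact: linearNl. Qed.

Lemma formZl (B : {symmetric U}) a x y : B (a *: y) x = a * B y x.
Proof. exact: linearZl_LR. Qed.
End DualArith.

(** * The second order expansion at Q *)

Section Taylor.
Context {R : realType} {V : lmodType R} {A : affineSpace V} (m : Met A) (Q : A).
Let g := metric_form m.

(** The remainder of second order is the same for all d in the class m, as they
    share their hessian. *)
Lemma quadM_taylor (d : QuadM m) x :
  d (trans Q x) = d Q + grad Q d x + 2^-1 * g x x.
Proof.
have := metric_formE d Q (trans Q x); rewrite transK homogE gradE -/g.
lra.
Qed.

Lemma grad_trans (d : QuadM m) (s : Aff A) x :
  grad Q (trans d s : QuadM m) x = grad Q d x + diff s x.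
Proof.
have := diffE s Q (- x); rewrite dual_argN (diffE s Q) !gradE => sN.
have E P : (trans d s : QuadM m) P = d P + s P.
  by [].
by rewrite !E; lra.
Qed.

Lemma grad_delta x y : grad Q (delta m (trans Q x)) y = - g x y.
Proof.
have E z : delta m (trans Q x) (trans Q z) = 2^-1 * g (z - x) (z - x).
  by rewrite -(vec_trans Q).
rewrite gradE !E !(formDl, formDr, formNl, formNr) (formC g y x).
lra.
Qed.

Lemma aff_of_tripleE (p : R^o * R^o * V) (d : QuadM m) :
  aff_of_triple m Q p d = p.1.1 + p.1.2 * d Q + grad Q d p.2.
Proof. by rewrite -[LHS]/(p.1.1 * 1 + _ + _) mulr1. Qed.

Lemma aff_of_triple_linear : linear (aff_of_triple m Q).
Proof.
move=> a p q; apply: aff_inj => d.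
rewrite -[RHS]/(a * aff_of_triple m Q p d + aff_of_triple m Q q d).
rewrite !aff_of_tripleE.
rewrite -[(a *: p + q).2]/(a *: p.2 + q.2).
rewrite -[(a *: p + q).1.1]/(a * p.1.1 + q.1.1).
by rewrite -[(a *: p + q).1.2]/(a * p.1.2 + q.1.2) dual_argD dual_argZ; ring.
Qed.

(** The linear part of T(a, b, x) is b z_Q + x. *)
Lemma aff_of_triple_trans p (d : QuadM m) (s : Aff A) :
  aff_of_triple m Q p (trans d s) =
    aff_of_triple m Q p d + (p.1.2 * s Q + diff s p.2).
Proof.
rewrite !aff_of_tripleE grad_trans.
by rewrite -[(trans d s : QuadM m) Q]/(d Q + s Q); ring.
Qed.

(** The Taylor formula read as an identity between functionals of d. *)
Lemma v_at_triple x :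
  v_at m (trans Q x) = aff_of_triple m Q (2^-1 * g x x : R^o, 1 : R^o, x).
Proof.
apply: aff_inj => d; rewrite aff_of_tripleE -[LHS]/(d (trans Q x)) quadM_taylor.
rewrite -/g; cbn [fst snd].
by rewrite mul1r; ring.
Qed.

Lemma aff_of_dual_affine (f : dual V) : affine_fun (fun P : A => f (vec Q P)).
Proof.
move=> a b ab P S; rewrite -(vecK Q P) -(vecK Q S) comb_trans !transK.
rewrite dual_argD dual_argZ dual_argD dual_argN -[a](addrK b) ab; ring.
Qed.

Definition aff_of_dual (f : dual V) : Aff A := mkaff (aff_of_dual_affine f).

Lemma diff_aff_of_dual (f : dual V) x : diff (aff_of_dual f) x = f x.
Proof.
by rewrite (diffE _ Q) -[LHS]/(f _ - f _) transK vecxx dual_arg0 subr0.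
Qed.

Lemma aff_decomp (s : Aff A) : s = s Q *: cst_aff A 1 + aff_of_dual (diff s).
Proof.
apply: aff_inj => P; rewrite -[RHS]/(s Q * 1 + diff s (vec Q P)).
by rewrite (diffE _ Q) vecK mulr1 addrC subrK.
Qed.

Lemma diff_cst c x : diff (c *: cst_aff A 1) x = 0.
Proof. by rewrite (diffE _ Q); apply: subrr. Qed.
End Taylor.

(** * The coordinates of the affine functionals *)

Section Triple.
Context {R : realType} {V : vectType R} {A : affineSpace V} (m : Met A) (Q : A).
Let g := metric_form m.

(** Splitting an affine function s into s(Q) and its linear part turns a
    functional of s into a number and an element of the bidual of V, that is, a
    vector. *)
Lemma hull_decomp (h : hull A) :
  exists x, forall s : Aff A, h s = h (cst_aff A 1) * s Q + diff s x.
Proof.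
have phi_lin : linear_for *%R (fun f : dual V => h (aff_of_dual Q f) : R).
  by move=> a f k; rewrite -linearP; congr (h _); apply: aff_inj.
have [x hx] := vect_bidual_eval (mkdual phi_lin); exists x => s.
by rewrite {1}(aff_decomp Q s) linearD linearZ -(hx (diff s)) mulrC.
Qed.

Lemma diff_separates (x : V) : (forall s : Aff A, diff s x = 0) -> x = 0.
Proof.
by move=> s0; apply: dual_separates => f; rewrite -(diff_aff_of_dual Q) s0.
Qed.

Lemma aff_of_triple_bijective : bijective (aff_of_triple m Q).
Proof.
apply: inj_surj_bijective.
  move=> p q pq; apply/eqP; rewrite -subr_eq0; apply/eqP.
  have: aff_of_triple m Q (p - q) = 0.
    by rewrite -scaleN1r addrC aff_of_triple_linear pq scaleN1r addNr.
  move: (p - q) => [[a b] x] T0.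
  have T0d (d : QuadM m) : aff_of_triple m Q (a, b, x) d = 0 by rewrite T0.
  have bx (s : Aff A) : b * s Q + diff s x = 0.
    by have := aff_of_triple_trans Q (a, b, x) (delta m Q) s;
      rewrite !T0d add0r.
  have b0 : b = 0.
    have := bx (cst_aff A 1).
    by rewrite (diffE _ Q) -[cst_aff A 1 _]/(1 : R) subrr addr0 mulr1.
  have x0 : x = 0.
    by apply: diff_separates => s; have := bx s; rewrite b0 mul0r add0r.
  have := T0d (delta m Q); rewrite aff_of_tripleE; cbn [fst snd].
  by rewrite b0 x0 mul0r addr0 dual_arg0 addr0 => ->.
(* The coefficients b and x are dictated by the linear part of v, and the
   constant a then adjusts the value at delta^m_Q. *)
move=> v.
have [x hx] := hull_decomp (d_m v).
pose b := d_m v (cst_aff A 1).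
pose d0 := delta m Q.
exists (v d0 - aff_of_triple m Q (0 : R^o, b : R^o, x) d0 : R^o, b : R^o, x).
apply: aff_inj => d; rewrite -(vecK d0 d); move: (vec d0 d) => s.
rewrite aff_of_triple_trans !aff_of_tripleE; cbn [fst snd].
have := hx s; rewrite -/b [d_m v s](diffE v d0) => vs.
suff -> : v (trans d0 s) = v d0 + (b * s Q + diff s x) by ring.
by rewrite -vs addrC subrK.
Qed.

Lemma aff_of_triple_inverse :
  exists S : Aff (QuadM m) -> R^o * R^o * V,
    [/\ linear S, cancel (aff_of_triple m Q) S & cancel S (aff_of_triple m Q)].
Proof.
have [S TS ST] := aff_of_triple_bijective; exists S; split=> //.
exact: (inverse_linear (@aff_of_triple_linear _ _ _ m Q) TS ST).
Qed.

(** Linear extensions from Quad_m(A) to its hull are unique: by reflexivity, a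
    functional on the hull is evaluation at some v in Aff(Quad_m A), and v is
    zero if it vanishes at every d. *)
Lemma hgradE (h : hull (QuadM m)) x : hgrad m Q h x = h (gradT m Q x).
Proof.
have N_ev (d : QuadM m) : hgrad m Q (ev d) = grad Q d.
  exact: (projT2 (cid (hgrad_exists m Q))).
have phi_lin : linear_for *%R
    (fun k : hull (QuadM m) => hgrad m Q k x - k (gradT m Q x) : R).
  by move=> a k l; rewrite linearP !dualD !dualZ; ring.
have [S [S_lin _ ST]] := aff_of_triple_inverse.
have [v hv] :=
  bidual_eval (@aff_of_triple_linear _ _ _ m Q) S_lin ST (mkdual phi_lin).
have v0 : v = 0.
  apply: aff_inj => d; have := hv (ev d).
  rewrite -[LHS]/(hgrad m Q (ev d) x - grad Q d x) N_ev subrr => /esym; exact.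
by apply/eqP; rewrite -subr_eq0; apply/eqP; have := hv h; rewrite v0 dual_arg0.
Qed.

Lemma pairing_adjoint (h : hull (QuadM m)) p :
  h (aff_of_triple m Q p) = pairing (triple_of_hull Q h) p.
Proof.
rewrite /aff_of_triple !dual_argD !dual_argZ /pairing; cbn [fst snd].
rewrite -[(triple_of_hull Q h).2]/(hgrad m Q h) hgradE.
by congr (_ + _ + _); apply: mulrC.
Qed.

Lemma triple_of_hull_linear : linear (@triple_of_hull R V A m Q).
Proof. by move=> a h k; rewrite /triple_of_hull linearP. Qed.

(** By adjointness this map is the transpose of the bijection T, so a functional
    with given image s is v |-> pairing s (T^-1 v). *)
Lemma triple_of_hull_bijective : bijective (@triple_of_hull R V A m Q).
Proof.
have [S [S_lin TS ST]] := aff_of_triple_inverse.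
apply: inj_surj_bijective => [h k hk|s].
  by apply: dual_inj => v; rewrite -(ST v) !pairing_adjoint hk.
have h_lin : linear_for *%R (fun v => pairing s (S v)).
  move=> a v w; rewrite S_lin /pairing.
  rewrite -[(a *: S v + S w).2]/(a *: (S v).2 + (S w).2) dual_argD dual_argZ.
  rewrite -[(a *: S v + S w).1.1]/(a * (S v).1.1 + (S w).1.1).
  by rewrite -[(a *: S v + S w).1.2]/(a * (S v).1.2 + (S w).1.2); ring.
exists (mkdual h_lin).
have hE p : pairing (triple_of_hull Q (mkdual h_lin)) p = pairing s p.
  by rewrite -pairing_adjoint -[LHS]/(pairing s (S _)) TS.
move: (triple_of_hull Q _) hE => [[a b] f]; case: s {h_lin} => [[a' b'] f'].
rewrite /pairing /= => hE; congr (_, _, _).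
- by have := hE (1 : R^o, 0 : R^o, 0);
    rewrite /= !dual_arg0 !mulr1 !mulr0 !addr0.
- by have := hE (0 : R^o, 1 : R^o, 0);
    rewrite /= !dual_arg0 !mulr1 !mulr0 !addr0 !add0r.
- apply: dual_inj => x.
  by have := hE (0 : R^o, 0 : R^o, x); rewrite /= !mulr0 !add0r.
Qed.

(** * The Cayley-Menger form in these coordinates *)

Lemma aff_of_triple_Aff0 a x : in_Aff0 (aff_of_triple m Q (a, 0, x)).
Proof.
by move=> d c; rewrite aff_of_triple_trans mul0r add0r (diff_cst Q) addr0.
Qed.

Lemma d_m_aff_of_triple a x :
  d_m (aff_of_triple m Q (a, 0, x)) = vec_hull A x.
Proof.
apply: dual_inj => s; rewrite -[RHS]/(diff s x) [LHS](diffE _ (delta m Q)).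
by rewrite aff_of_triple_trans mul0r add0r addrC addKr.
Qed.

Lemma vec_hull_inj : injective (@vec_hull R V A).
Proof.
move=> x y xy; apply/eqP; rewrite -subr_eq0; apply/eqP/diff_separates => s.
by rewrite dual_argD dual_argN -[diff s x]/(vec_hull A x s) xy subrr.
Qed.

(** The right-hand side is the form (swap, - g) evaluated at p and at the
    coordinates of v_P, for P = Q + x. *)
Lemma aff_of_triple_delta x p :
  aff_of_triple m Q p (delta m (trans Q x)) =
    p.1.1 + p.1.2 * (2^-1 * g x x) - g x p.2.
Proof.
rewrite aff_of_tripleE grad_delta -[delta _ _ Q]/(2^-1 * g (vec _ _) (vec _ _)).
have -> : vec (trans Q x) Q = - x.
  by rewrite -{2}(trans0 Q) vec_trans sub0r.
by rewrite formNl formNr opprK.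
Qed.

Lemma aff_of_triple_delta0 p : aff_of_triple m Q p (delta m Q) = p.1.1.
Proof.
by have := aff_of_triple_delta 0 p; rewrite trans0 !linear0l !mulr0 addr0 subr0.
Qed.

(** Up to a multiple of v_Q, every functional lies in Aff_0(Quad_m A).  The
    values on pairs in Aff_0 are prescribed by the first condition, and those
    on pairs with v_Q by the second one at P = Q. *)
Lemma is_CM_in_triple_coordinates B : is_CM B -> forall p q,
  B (aff_of_triple m Q p) (aff_of_triple m Q q) =
    swap_form p.1 q.1 - g p.2 q.2.
Proof.
move=> [B0 Bd] [[a b] x] [[a' b'] y].
have TE c d z : aff_of_triple m Q (c, d, z) =
    aff_of_triple m Q (c, 0, z) + d *: v_at m Q.
  by rewrite /aff_of_triple /= scale0r addr0 addrAC.
have BvQ p : B (v_at m Q) (aff_of_triple m Q p) = p.1.1.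
  by rewrite -[LHS]/(flat B (v_at m Q) _) Bd -[LHS]/(aff_of_triple _ _ _ _)
    aff_of_triple_delta0.
rewrite [in LHS](TE a) formDl formZl BvQ (TE a') formDr formZr.
rewrite (formC B _ (v_at m Q)) BvQ.
rewrite (B0 _ _ x y) ?d_m_aff_of_triple //; try exact: aff_of_triple_Aff0.
by rewrite /swap_form -/g /=; ring.
Qed.

(** The second condition is required at every P, not only at Q; it holds by the
    Taylor expansion of v_P. *)
Lemma is_CM_exists : exists B, @is_CM R V A m B.
Proof.
have [S [S_lin TS ST]] := aff_of_triple_inverse.
pose f v w : R := swap_form (S v).1 (S w).1 - g (S v).2 (S w).2.
have fC v w : f v w = f w v.
  by rewrite /f (formC g) /swap_form; ring.
have f_lin v : linear_for *%R (f v).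
  move=> a w z; rewrite /f S_lin /swap_form.
  rewrite -[(a *: S w + S z).2]/(a *: (S w).2 + (S z).2) formDr formZr.
  rewrite -[(a *: S w + S z).1.1]/(a * (S w).1.1 + (S z).1.1).
  by rewrite -[(a *: S w + S z).1.2]/(a * (S w).1.2 + (S z).1.2); ring.
exists (mksym fC f_lin); split=> [v1 v2 x1 x2|P].
  rewrite -(ST v1) -(ST v2); case: (S v1) (S v2) => [[a b] x] [[a' b'] y].
  (* Translation by the constant u adds d to the value of T(c, d, z). *)
  have b0 c d z : in_Aff0 (aff_of_triple m Q (c, d, z)) -> d = 0.
    move=> /(_ (delta m Q) 1); rewrite aff_of_triple_trans (diff_cst Q).
    rewrite -[(1 *: cst_aff A 1) Q]/(1 * 1 : R) addr0 !mulr1 => /eqP.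
    by rewrite -subr_eq0 addrC addKr => /eqP.
  move=> /b0 -> /b0 ->; rewrite !d_m_aff_of_triple.
  move=> /vec_hull_inj <- /vec_hull_inj <-.
  by rewrite -[LHS]/(f _ _) /f !TS /swap_form /= !mulr0 !mul0r addr0 add0r.
apply: dual_inj => w; rewrite -(ST w) -(vecK Q P); move: (vec Q P) (S w) => x p.
rewrite -[RHS]/(aff_of_triple _ _ _ _) aff_of_triple_delta v_at_triple.
by rewrite -[LHS]/(f _ _) /f !TS /swap_form /=; ring.
Qed.

Lemma CM_is_CM : is_CM (CM m).
Proof.
rewrite /CM; case: pselect => [ex|]; last by case; apply: is_CM_exists.
exact: (projT2 (cid ex)).
Qed.

Lemma CM_in_triple_coordinates p q :
  CM m (aff_of_triple m Q p) (aff_of_triple m Q q) =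
    swap_form p.1 q.1 - g p.2 q.2.
Proof. exact: is_CM_in_triple_coordinates CM_is_CM p q. Qed.

Lemma v_m_triple : v_m m = aff_of_triple m Q (1, 0, 0).
Proof.
apply: aff_inj => d; rewrite aff_of_tripleE; cbn [fst snd].
by rewrite dual_arg0 mul0r !addr0.
Qed.

Lemma gradT_triple x : gradT m Q x = aff_of_triple m Q (0, 0, x).
Proof.
apply: aff_inj => d; rewrite aff_of_tripleE; cbn [fst snd].
by rewrite mul0r !add0r.
Qed.

Lemma v_at_base_triple : v_at m Q = aff_of_triple m Q (0, 1, 0).
Proof.
apply: aff_inj => d; rewrite aff_of_tripleE; cbn [fst snd].
by rewrite dual_arg0 mul1r add0r addr0.
Qed.

Lemma triple_of_hull_CM p :
  triple_of_hull Q (flat (CM m) (aff_of_triple m Q p)) =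
    (swap p.1, - flat g p.2).
Proof.
case: p => [[a b] x]; rewrite /swap /=; congr (_, _, _).
- rewrite v_m_triple -[LHS]/(CM m _ _) CM_in_triple_coordinates.
  by rewrite /swap_form form0r /=; ring.
- rewrite v_at_base_triple -[LHS]/(CM m _ _) CM_in_triple_coordinates.
  by rewrite /swap_form form0r /=; ring.
- apply: dual_inj => y; rewrite hgradE gradT_triple -[LHS]/(CM m _ _).
  rewrite CM_in_triple_coordinates.
  by rewrite /swap_form /= !mulr0 add0r sub0r.
Qed.

(** * The isometry with a hyperbolic plane plus (V, - g) *)

Lemma CM_bijective : nondegenerate g -> bijective (flat (CM m)).
Proof.
move=> /flat_bijective [gi gK giK].
have [S [_ _ ST]] := aff_of_triple_inverse.
apply: inj_surj_bijective => [v w|h].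
  rewrite -(ST v) -(ST w); case: (S v) (S w) => [[a b] x] [[a' b'] y] vw.
  have := congr1 (triple_of_hull Q) vw; rewrite !triple_of_hull_CM.
  case/pair_equal_spec=> /pair_equal_spec [/= -> ->] /oppr_inj gxy.
  by rewrite (can_inj gK gxy).
exists (aff_of_triple m Q (swap (triple_of_hull Q h).1, gi (- hgrad m Q h))).
apply: (bij_inj triple_of_hull_bijective).
by rewrite triple_of_hull_CM /= giK opprK.
Qed.

(** The isometry is the inverse of T after the inverse of the Cayley-Menger
    map: on elements CM(v) and CM(w) of the hull, the inverse form takes the
    value CM(v, w). *)
Lemma CM_isometric : nondegenerate g ->
  isometric (inverse_form (CM m))
    (sum_form (@swap_form R) (fun x y : V => - g x y)).
Proof.
move=> /CM_bijective CM_bij.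
have [F CF FC] := CM_bij.
have [S [S_lin TS ST]] := aff_of_triple_inverse.
have F_lin := inverse_linear (flat_linear (CM m)) CF FC.
exists (S \o F); split.
  split; first by move=> a h k; rewrite /= F_lin S_lin.
  by exists (flat (CM m) \o aff_of_triple m Q) => h /=; rewrite ?ST ?FC ?CF ?TS.
move=> s t; rewrite -[(S \o F) s]/(S (F s)) -[(S \o F) t]/(S (F t)).
rewrite -(FC s) -(FC t) !CF -(ST (F s)) -(ST (F t)) !TS.
move: (S (F s)) (S (F t)) => p q.
rewrite /inverse_form pinvKV ?inE //; last by move=> ? ? _ _; apply: bij_inj.
rewrite -[RHS]/(CM m _ _) CM_in_triple_coordinates.
by rewrite /sum_form /swap_form (formC g); ring.
Qed.
End Triple.

Theorem proposition5p17 (R : realType) (V : vectType R) (A : affineSpace V)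
    (m : Met A) (Q : A) :
  [/\ is_isomorphism (aff_of_triple m Q),
      is_isomorphism (@triple_of_hull R V A m Q),
      (forall (h : hull (QuadM m)) (p : R^o * R^o * V),
         h (aff_of_triple m Q p) = pairing (triple_of_hull Q h) p),
      (forall p : R^o * R^o * V,
         triple_of_hull Q (flat (CM m) (aff_of_triple m Q p)) =
           (swap p.1, - flat (metric_form m) p.2))
    & nondegenerate (metric_form m) ->
        bijective (flat (CM m)) /\
        isometric (inverse_form (CM m))
          (sum_form (@swap_form R) (fun x y : V => - metric_form m x y))].
Proof.
split.
- split; [exact: aff_of_triple_linear | exact: aff_of_triple_bijective].
- split; [exact: triple_of_hull_linear | exact: triple_of_hull_bijective].
- exact: pairing_adjoint.
- exact: triple_of_hull_CM.
- by move=> g_nd; split; [exact: CM_bijective | exact: CM_isometric].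
Qed.
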